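(* Let $E$ be a graph, $K$ a field with involution and $R$ an involutive $K$-algebra. Restriction to $E^0$ gives a bijection between the set of positive, canonical, $K$-linear, $R$-valued traces on $L_K(E)$ and the set of positive $R$-valued graph traces on $E$ (the inverse sends $\delta$ to the unique canonical $K$-linear trace $t_\delta$ with $t_\delta(pq^* )=\delta_{p,q}\delta(\mathbf{r}(p))$). If, in addition, the involution of $R$ is positive definite, restriction to $E^0$ gives a bijection between the set of faithful, canonical, $K$-linear, $R$-valued traces on $L_K(E)$ and the set of faithful $R$-valued graph traces on $E$.
   Context: A (directed) graph $E=(E^0,E^1,\mathbf{s},\mathbf{r})$ has vertex set $E^0$, edge set $E^1$, source and range maps; no finiteness or countability is assumed. A path is a vertex $v$ (length $0$, $\mathbf{s}(v)=\mathbf{r}(v)=v$) or a sequence $p=e_1\cdots e_n$ of edges with $\mathbf{r}(e_i)=\mathbf{s}(e_{i+1})$, $\mathbf{s}(p)=\mathbf{s}(e_1)$, $\mathbf{r}(p)=\mathbf{r}(e_n)$. A vertex $v$ is regular if $\mathbf{s}^{-1}(v)$ is nonempty and finite. $K$ is a field with an arbitrary involution. $L_K(E)$ is the free $K$-algebra generated by $E^0\cup E^1\cup\{e^*:e\in E^1\}$ subject to (V) $vw=\delta_{v,w}v$; (E1) $\mathbf{s}(e)e=e\mathbf{r}(e)=e$; (E2) $\mathbf{r}(e)e^*=e^*\mathbf{s}(e)=e^*$; (CK1) $e^*f=\delta_{e,f}\mathbf{r}(e)$; (CK2) $v=\sum_{e\in\mathbf{s}^{-1}(v)}ee^*$ for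 regular $v$; with $p^*=e_n^*\cdots e_1^*$, $v^*=v$, it is involutive via $(\sum a_ip_iq_i^* )^*=\sum a_i^*q_ip_i^*$. An involutive $K$-algebra is a $K$-algebra with an involution satisfying $(ax)^*=a^*x^*$. $x\ge0$ means $x$ is a finite sum of elements $zz^*$; $x>0$ means $x\ge 0$, $x\ne0$; $x\ge y$ means $x-y\ge0$; the involution is positive definite if $\sum x_ix_i^*=0$ implies all $x_i=0$. A trace is an additive map with $t(xy)=t(yx)$; $K$-linear means $t(ax)=at(x)$; positive means $x\ge0\Rightarrow t(x)\ge0$; faithful means $x>0\Rightarrow t(x)>0$. A trace on $L_K(E)$ is canonical if $t(pq^* )=\delta_{p,q}t(\mathbf{r}(p))$ for all paths $p,q$ with $\mathbf{r}(p)=\mathbf{r}(q)$. An $R$-valued graph trace on $E$ is a map $\delta:E^0\to R$ with $\delta(v)=\sum_{e\in\mathbf{s}^{-1}(v)}\delta(\mathbf{r}(e))$ for every regular vertex $v$; it is positive if $\delta(v)\ge\sum_{e\in I}\delta(\mathbf{r}(e))$ for every vertex $v$ and every finite $I\subseteq\mathbf{s}^{-1}(v)$ (empty sum $=0$), and faithful if it is positive and $\delta(v)>0$ for every vertex $v$. *)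

(* Defs.v *)
From HB Require Import structures.
From mathcomp Require Import all_boot all_order all_algebra.
From Stdlib Require List.
Set Implicit Arguments. Unset Strict Implicit. Unset Printing Implicit Defensive.
Import GRing.Theory.
Local Open Scope ring_scope.

Record graph := Graph {
  vert : Type;
  edge : Type;
  src  : edge -> vert;
  rng  : edge -> vert }.

Definition enum_src (E : graph) (v : vert E) (l : seq (edge E)) : Prop :=
  List.NoDup l /\ forall e, src e = v <-> List.In e l.

Definition regular (E : graph) (v : vert E) : Prop :=
  exists l, enum_src v l /\ l <> [::].

(* Paths: a pair (v, [e1;...;en]); valid iff s(e1)=v and r(e_i)=s(e_{i+1}).
   Length 0 paths are (v, [::]), i.e. the vertex v.                    *)
Fixpoint chain (E : graph) (v : vert E) (l : seq (edge E)) : Prop :=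
  match l with
  | [::] => True
  | e :: l' => src e = v /\ chain (rng e) l'
  end.

Definition path (E : graph) := (vert E * seq (edge E))%type.
Definition is_path (E : graph) (p : path E) : Prop := chain p.1 p.2.
Definition psrc (E : graph) (p : path E) : vert E := p.1.
Definition prng (E : graph) (p : path E) : vert E :=
  foldl (fun _ e => rng e) p.1 p.2.

Record kAlg (K : fieldType) := KAlg {
  ka_car :> lmodType K;
  ka_mul : ka_car -> ka_car -> ka_car;
  ka_mulA : forall x y z, ka_mul x (ka_mul y z) = ka_mul (ka_mul x y) z;
  ka_mulDl : forall x y z, ka_mul (x + y) z = ka_mul x z + ka_mul y z;
  ka_mulDr : forall x y z, ka_mul x (y + z) = ka_mul x y + ka_mul x z;
  ka_mulZl : forall (a : K) x y, ka_mul (a *: x) y = a *: ka_mul x y;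
  ka_mulZr : forall (a : K) x y, ka_mul x (a *: y) = a *: ka_mul x y }.

Record invAlg (K : fieldType) (sig : K -> K) := InvAlg {
  ia_alg :> kAlg K;
  ia_star : ia_alg -> ia_alg;
  ia_starD : forall x y, ia_star (x + y) = ia_star x + ia_star y;
  ia_starK : forall x, ia_star (ia_star x) = x;
  ia_starM : forall x y, ia_star (ka_mul x y) = ka_mul (ia_star y) (ia_star x);
  ia_starZ : forall (a : K) x, ia_star (a *: x) = sig a *: ia_star x }.

Definition kHom (K : fieldType) (A B : kAlg K) (f : A -> B) : Prop :=
  (forall x y, f (x + y) = f x + f y) /\
  (forall (a : K) x, f (a *: x) = a *: f x) /\
  (forall x y, f (ka_mul x y) = ka_mul (f x) (f y)).

(* Families satisfying the Leavitt path algebra relations in B.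
   fv = vertices, fe = edges e, fs = ghost edges e^*.                  *)
Definition leavitt_family (K : fieldType) (E : graph) (B : kAlg K)
    (fv : vert E -> B) (fe fs : edge E -> B) : Prop :=
  (forall v, ka_mul (fv v) (fv v) = fv v) /\
  (forall v w, v <> w -> ka_mul (fv v) (fv w) = 0) /\
  (forall e, ka_mul (fv (src e)) (fe e) = fe e) /\
  (forall e, ka_mul (fe e) (fv (rng e)) = fe e) /\
  (forall e, ka_mul (fv (rng e)) (fs e) = fs e) /\
  (forall e, ka_mul (fs e) (fv (src e)) = fs e) /\
  (forall e, ka_mul (fs e) (fe e) = fv (rng e)) /\
  (forall e f, e <> f -> ka_mul (fs e) (fe f) = 0) /\
  (forall v l, enum_src v l -> l <> [::] ->
     fv v = \sum_(e <- l) ka_mul (fe e) (fs e)).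

(* L is (a model of) the Leavitt path algebra L_K(E): the K-algebra
   freely generated by E^0, E^1, (E^1)^* subject to the relations
   (V),(E1),(E2),(CK1),(CK2) (universal property), together with its
   standard involution (v^* = v, e |-> e^*, e^* |-> e, conjugate-linear). *)
Record LPA (K : fieldType) (sig : K -> K) (E : graph) := MkLPA {
  lpa :> invAlg sig;
  lv : vert E -> lpa;
  le : edge E -> lpa;
  ls : edge E -> lpa;
  lpa_family : leavitt_family lv le ls;
  lpa_star_v : forall v, ia_star (lv v) = lv v;
  lpa_star_e : forall e, ia_star (le e) = ls e;
  lpa_star_s : forall e, ia_star (ls e) = le e;
  lpa_univ : forall (B : kAlg K) fv fe fs, leavitt_family (B := B) fv fe fs ->
     exists f : lpa -> B, kHom f /\ (forall v, f (lv v) = fv v) /\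
       (forall e, f (le e) = fe e) /\ (forall e, f (ls e) = fs e);
  lpa_uniq : forall (B : kAlg K) (f g : lpa -> B), kHom f -> kHom g ->
     (forall v, f (lv v) = g (lv v)) -> (forall e, f (le e) = g (le e)) ->
     (forall e, f (ls e) = g (ls e)) -> forall x, f x = g x }.

(* The element of L associated with a path p = (v,[e1..en]): v e1 ... en
   (= e1...en for valid paths of positive length, = v for length 0). *)
Definition pval (K : fieldType) (sig : K -> K) (E : graph) (L : LPA sig E) (p : path E) : L :=
  foldl (fun x e => ka_mul x (le L e)) (lv L p.1) p.2.

Definition nonneg (K : fieldType) (sig : K -> K) (A : invAlg (K := K) sig) (x : A) : Prop :=
  exists l : seq A, x = \sum_(z <- l) ka_mul z (ia_star z).
Definition pos (K : fieldType) (sig : K -> K) (A : invAlg (K := K) sig) (x : A) : Prop :=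
  nonneg x /\ x <> 0.
Definition posdef (K : fieldType) (sig : K -> K) (A : invAlg (K := K) sig) : Prop :=
  forall l : seq A, \sum_(z <- l) ka_mul z (ia_star z) = 0 ->
    forall z, z \in l -> z = 0.

Definition is_trace (K : fieldType) (A B : kAlg K) (t : A -> B) : Prop :=
  (forall x y, t (x + y) = t x + t y) /\
  (forall x y, t (ka_mul x y) = t (ka_mul y x)).
Definition klinear (K : fieldType) (A B : kAlg K) (t : A -> B) : Prop :=
  forall (a : K) x, t (a *: x) = a *: t x.
Definition positive_map (K : fieldType) (sig : K -> K) (A B : invAlg (K := K) sig) (t : A -> B) : Prop :=
  forall x, nonneg x -> nonneg (t x).
Definition faithful_map (K : fieldType) (sig : K -> K) (A B : invAlg (K := K) sig) (t : A -> B) : Prop :=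
  forall x, pos x -> pos (t x).
Definition canonical_trace (K : fieldType) (sig : K -> K) E (L : LPA sig E) (B : kAlg K) (t : L -> B) :
  Prop :=
  forall p q : path E, is_path p -> is_path q -> prng p = prng q ->
    (p = q -> t (ka_mul (pval L p) (ia_star (pval L q))) = t (lv L (prng p))) /\
    (p <> q -> t (ka_mul (pval L p) (ia_star (pval L q))) = 0).

Definition graph_trace (K : fieldType) (E : graph) (B : kAlg K) (d : vert E -> B) : Prop :=
  forall v l, enum_src v l -> l <> [::] -> d v = \sum_(e <- l) d (rng e).
Definition pos_graph_trace (K : fieldType) (sig : K -> K) (E : graph) (B : invAlg (K := K) sig)
    (d : vert E -> B) : Prop :=
  graph_trace d /\
  forall v (l : seq (edge E)), List.NoDup l -> (forall e, List.In e l -> src e = v) ->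
    nonneg (d v - \sum_(e <- l) d (rng e)).
Definition faithful_graph_trace (K : fieldType) (sig : K -> K) (E : graph) (B : invAlg (K := K) sig)
    (d : vert E -> B) : Prop :=
  pos_graph_trace d /\ forall v, pos (d v).

(* Main.v *)
Require Import Defs.
From HB Require Import structures.
From mathcomp Require Import all_boot all_order all_algebra.
From mathcomp Require Import boolp functions.
Set Implicit Arguments. Unset Strict Implicit. Unset Printing Implicit Defensive.
Import GRing.Theory.
Local Open Scope ring_scope.

(** A canonical trace is determined on the spanning elements p q^*, so everything
    rests on two points.  Existence: functions (p, q) |-> phi(p, q) compatible
    with (CK2) are exactly the linear forms on L_K(E); they form a right module
    under the transpose of multiplication, so the universal property of L_K(E)
    turns such a phi into a linear form with value phi(p, q) at p q^*, without
    any normal form for L_K(E).  Positivity: order the pairs by (p, q) <= (pu, qu).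
    Over a finite down-closed set S of pairs put
    w_S(p, q) = p q^* - sum over (pe, qe) in S of (pe)(qe)^*.
    These elements span and satisfy t(w_S(s) w_S(s')^* ) = 0 for s <> s', while
    t(w_S(s) w_S(s)^* ) is delta(v) - sum_{e in I} delta(r(e)) for a finite set I
    of edges out of v.  So t(x x^* ) is a combination of nonnegative elements with
    coefficients a a^*.  If such an element vanishes for a faithful delta, then I
    exhausts s^{-1}(v), and w_S(s) = 0 by (CK2). *)

Local Notation path := Defs.path.
Local Notation "x ** y" := (ka_mul x y) (at level 40, left associativity).

(** Vertices and edges form arbitrary types; classical logic gives them boolean equality, so that
    Kronecker deltas become conditionals. *)
HB.instance Definition _ (E : graph) := gen_eqMixin (vert E).
HB.instance Definition _ (E : graph) := gen_choiceMixin (vert E).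
HB.instance Definition _ (E : graph) := gen_eqMixin (edge E).
HB.instance Definition _ (E : graph) := gen_choiceMixin (edge E).

(** * Subspaces, subalgebras and endomorphism algebras *)

Record subspace (K : fieldType) (V : lmodType K) := Subspace {
  ss_prop :> V -> Prop;
  ss_prop0 : ss_prop 0;
  ss_propZD : forall a x y, ss_prop x -> ss_prop y -> ss_prop (a *: x + y) }.

Section Subspace.
Variables (K : fieldType) (V : lmodType K) (S : subspace V).

Definition ss_mem : {pred V} := fun x => `[< S x >].

Lemma ss_memP x : reflect (S x) (x \in ss_mem).
Proof. exact: asboolP. Qed.

Lemma ss_submod : submod_closed ss_mem.
Proof.
split; first by apply/ss_memP/ss_prop0.
by move=> a x y /ss_memP Sx /ss_memP Sy; apply/ss_memP/ss_propZD.
Qed.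

HB.instance Definition _ := GRing.isSubmodClosed.Build K V ss_mem ss_submod.

Record ss_sort := SsSort { ss_val :> V; ss_valP : ss_val \in ss_mem }.
HB.instance Definition _ := [isSub for ss_val].
HB.instance Definition _ := [Choice of ss_sort by <:].
HB.instance Definition _ := [SubChoice_isSubLmodule of ss_sort by <:].

Definition ss_in x (Sx : S x) : ss_sort := SsSort (introT (ss_memP x) Sx).

Lemma ss_valS (x : ss_sort) : S (ss_val x).
Proof. exact/ss_memP/ss_valP. Qed.
Lemma ss_valD (x y : ss_sort) : ss_val (x + y) = ss_val x + ss_val y.
Proof. by []. Qed.
Lemma ss_valZ a (x : ss_sort) : ss_val (a *: x) = a *: ss_val x.
Proof. by []. Qed.

End Subspace.

Lemma ss_val_inj (K : fieldType) (V : lmodType K) (S : subspace V) :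
  injective (@ss_val K V S).
Proof. exact: val_inj. Qed.

Section Additive.
Variables (U V : zmodType) (f : U -> V).
Hypothesis fD : forall x y, f (x + y) = f x + f y.

Lemma additive0 : f 0 = 0.
Proof. by apply: (addIr (f 0)); rewrite -fD !add0r. Qed.

Lemma additiveN x : f (- x) = - f x.
Proof. by apply: (addIr (f x)); rewrite -fD !addNr additive0. Qed.

Lemma additiveB x y : f (x - y) = f x - f y.
Proof. by rewrite fD additiveN. Qed.

Lemma additive_sum I r (P : pred I) (F : I -> U) :
  f (\sum_(i <- r | P i) F i) = \sum_(i <- r | P i) f (F i).
Proof. by apply: (big_morph f fD); exact: additive0. Qed.

Lemma additive_if (b : bool) x : f (if b then x else 0) = if b then f x else 0.
Proof. by case: b; rewrite ?additive0. Qed.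
End Additive.

Section KAlgTheory.
Variables (K : fieldType) (A : kAlg K).
Implicit Types x y z : A.

Lemma ka_mul0l x : ka_mul 0 x = 0.
Proof. exact: (additive0 (fun y z => ka_mulDl y z x)). Qed.

Lemma ka_mul0r x : ka_mul x 0 = 0.
Proof. exact: (additive0 (ka_mulDr x)). Qed.

Lemma ka_mulBl x y z : ka_mul (x - y) z = ka_mul x z - ka_mul y z.
Proof. exact: (additiveB (fun y z' => ka_mulDl y z' z)). Qed.

Lemma ka_mulBr x y z : ka_mul z (x - y) = ka_mul z x - ka_mul z y.
Proof. exact: (additiveB (ka_mulDr z)). Qed.

Lemma ka_mul_suml I r (P : pred I) (F : I -> A) z :
  ka_mul (\sum_(i <- r | P i) F i) z = \sum_(i <- r | P i) ka_mul (F i) z.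
Proof. exact: (additive_sum (fun y z' => ka_mulDl y z' z)). Qed.

Lemma ka_mul_sumr I r (P : pred I) (F : I -> A) z :
  ka_mul z (\sum_(i <- r | P i) F i) = \sum_(i <- r | P i) ka_mul z (F i).
Proof. exact: (additive_sum (ka_mulDr z)). Qed.
End KAlgTheory.

Section SubAlgebra.
Variables (K : fieldType) (A : kAlg K) (S : subspace A).
Hypothesis SM : forall x y, S x -> S y -> S (ka_mul x y).

Definition subalg_mul (x y : ss_sort S) : ss_sort S :=
  ss_in (SM (ss_valS x) (ss_valS y)).

Definition subalg : kAlg K.
Proof.
apply: (@KAlg K (ss_sort S : lmodType K) subalg_mul).
- by move=> x y z; apply: ss_val_inj; exact: ka_mulA.
- by move=> x y z; apply: ss_val_inj; exact: ka_mulDl.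
- by move=> x y z; apply: ss_val_inj; exact: ka_mulDr.
- by move=> a x y; apply: ss_val_inj; exact: ka_mulZl.
- by move=> a x y; apply: ss_val_inj; exact: ka_mulZr.
Defined.
End SubAlgebra.

Section EndoOp.
Variables (K : fieldType) (V : lmodType K).

Definition linear_subspace : subspace (V -> V).
Proof.
apply: (@Subspace K ((V -> V) : lmodType K)
  (fun f : V -> V => forall a x y, f (a *: x + y) = a *: f x + f y)).
- by move=> a x y; rewrite /= scaler0 addr0.
- move=> b f g fP gP a x y; rewrite !fctE fP gP !scalerDr !scalerA mulrC.
  exact: addrACA.
Defined.

Definition endo := ss_sort linear_subspace.

Lemma endoZD (f : endo) a x y : ss_val f (a *: x + y) = a *: ss_val f x + ss_val f y.
Proof. exact: (ss_valS f a x y). Qed.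

Lemma endoD (f : endo) x y : ss_val f (x + y) = ss_val f x + ss_val f y.
Proof. by have := endoZD f 1 x y; rewrite !scale1r. Qed.

Lemma endoZ (f : endo) a x : ss_val f (a *: x) = a *: ss_val f x.
Proof. by have := endoZD f a x 0; rewrite (additive0 (endoD f)) !addr0. Qed.

Definition endo_mul (f g : endo) : endo.
Proof.
apply: (@ss_in _ _ linear_subspace (fun x => ss_val g (ss_val f x))).
by move=> a x y; rewrite !endoZD.
Defined.

(* The product is reversed composition, so that an algebra morphism into
   [endo_op] is a right module structure on [V]. *)
Definition endo_op : kAlg K.
Proof.
apply: (@KAlg K (endo : lmodType K) endo_mul).
- by move=> x y z; apply: ss_val_inj.
- by move=> x y z; apply: ss_val_inj; apply/funext => v /=; rewrite endoD.
- by move=> x y z; apply: ss_val_inj.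
- by move=> a x y; apply: ss_val_inj; apply/funext => v /=; rewrite endoZ.
- by move=> a x y; apply: ss_val_inj.
Defined.
End EndoOp.

(** * Pairs of paths *)

Section PathPairs.
Variable E : graph.

Lemma prng_cat v (l m : seq (edge E)) : prng (v, l ++ m) = prng (prng (v, l), m).
Proof. by rewrite /prng /= foldl_cat. Qed.

Lemma chain_cat (v : vert E) l m :
  chain v (l ++ m) <-> chain v l /\ chain (prng (v, l)) m.
Proof.
elim: l v => [|e l IHl] v /=; first by split=> // -[].
by rewrite IHl /prng /=; split=> [[-> [? ?]]|[[-> ?] ?]].
Qed.

Lemma In_mem (T : eqType) x (s : seq T) : List.In x s <-> x \in s.
Proof.
elim: s => //= y s IHs; rewrite in_cons IHs; split.
  by case=> [->|->]; rewrite ?eqxx ?orbT.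
by case/orP=> [/eqP->|]; [left|right].
Qed.

Lemma NoDup_uniq (T : eqType) (l : seq T) : List.NoDup l <-> uniq l.
Proof.
elim: l => [|x l IHl] /=; first by split=> // _; constructor.
split=> [H|/andP[xl ul]].
  by inversion H; subst; apply/andP; split; [apply/negP => /In_mem|apply/IHl].
by constructor; [move/In_mem; rewrite (negbTE xl)|apply/IHl].
Qed.

Lemma enum_srcP (v : vert E) l :
  enum_src v l <-> uniq l /\ forall e, (e \in l) = (src e == v).
Proof.
rewrite /enum_src NoDup_uniq; split=> -[ul H]; split=> // e.
  by apply/idP/eqP => [/In_mem/H|/H/In_mem].
by rewrite In_mem H; split=> [/eqP|/eqP].
Qed.

Definition valid (s : path E * path E) : Prop :=
  is_path s.1 /\ is_path s.2 /\ prng s.1 = prng s.2.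

(** For a single edge e, the pair (pe, qe) indexes one term of p q^* after (CK2) is inserted between
    p and q^*. *)
Definition shift (s : path E * path E) (u : seq (edge E)) : path E * path E :=
  ((s.1.1, s.1.2 ++ u), (s.2.1, s.2.2 ++ u)).

(** Each of the two extended paths forces its original range to be [src e], so the two ranges
    agree. *)
Lemma valid_shift1 s e :
  valid (shift s [:: e]) <-> valid s /\ src e = prng s.1.
Proof.
case: s => [[v l] [w m]]; rewrite /valid /is_path /= !prng_cat !chain_cat /=.
split=> [[[? [H _]] [[? [H' _]] _]]|[[? [? H]] ->]]; last by rewrite H.
by do !split; rewrite // -H -H'.
Qed.

Lemma valid_cons l q (e : edge E) :
  valid ((src e, e :: l), q) <-> valid ((rng e, l), q).
Proof. by rewrite /valid /is_path /=; split=> [[[_ ?]]|[]]. Qed.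

End PathPairs.

(** * Functionals on a Leavitt path algebra *)

Section Functional.
Variables (K : fieldType) (E : graph) (M : lmodType K).
Local Notation index := (option (path E * path E)).

(* [psi] stands for the linear form on the unitization of the algebra with
   [psi None] its value at 1 and [psi (Some (p, q))] its value at p q^*. *)
Definition functional_subspace : subspace (index -> M).
Proof.
apply: (@Subspace K ((index -> M) : lmodType K) (fun psi : index -> M =>
  (forall s, ~ valid s -> psi (Some s) = 0) /\
  (forall s l, valid s -> enum_src (prng s.1) l -> l <> [::] ->
     psi (Some s) = \sum_(e <- l) psi (Some (shift s [:: e]))))).
- by split=> // s l _ _ _; rewrite big1.
- move=> a f g [f0 fS] [g0 gS]; split=> [s ns|s l vs sl l0]; rewrite !fctE.
    by rewrite f0 ?g0 // scaler0 addr0.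
  by rewrite (fS _ _ vs sl l0) (gS _ _ vs sl l0) scaler_sumr -big_split.
Defined.

Local Notation functional := (ss_sort functional_subspace).

(** [act_v], [act_e] and [act_s] are the transposes of left multiplication by w, e and e^*: the
    value at x is the value of [psi] at w x, e x or e^* x, computed by (V), (E1), (E2) and (CK1). At
    [None] it is the value at the generator itself, written as w w^*, e r(e)^* or r(e) e^*. *)
Definition act_v (w : vert E) (psi : index -> M) : index -> M := fun i =>
  match i with
  | None => psi (Some ((w, [::]), (w, [::])))
  | Some (p, q) => if p.1 == w then psi (Some (p, q)) else 0
  end.

Definition act_e (e : edge E) (psi : index -> M) : index -> M := fun i =>
  match i with
  | None => psi (Some ((src e, [:: e]), (rng e, [::])))
  | Some (p, q) =>
    if p.1 == rng e then psi (Some ((src e, e :: p.2), q)) else 0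
  end.

Definition act_s (e : edge E) (psi : index -> M) : index -> M := fun i =>
  match i with
  | None => psi (Some ((rng e, [::]), (src e, [:: e])))
  | Some ((v, [::]), q) =>
    if v == src e then psi (Some ((rng e, [::]), (q.1, q.2 ++ [:: e]))) else 0
  | Some ((v, f :: l), q) =>
    if (v == src e) && (f == e) then psi (Some ((rng e, l), q)) else 0
  end.

Lemma act_v_stable w psi : functional_subspace psi -> functional_subspace (act_v w psi).
Proof.
move=> [p0 pS]; split=> [[p q] ns|[p q] l vs sl l0] /=.
  by case: ifP => // _; apply: p0.
by case: ifP => _; [apply: pS|rewrite big1].
Qed.

Lemma act_e_stable e psi : functional_subspace psi -> functional_subspace (act_e e psi).
Proof.
move=> [p0 pS]; split=> [[[v l] q] ns|[[v m] q] l vs sl l0] /=.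
  case: eqP => //= vE; apply: p0; move/valid_cons => //.
  by rewrite -vE.
case: eqP => /= vE; last by rewrite big1.
subst v; apply: (pS ((_, _), q)) => //; exact/valid_cons.
Qed.

Lemma act_s_stable e psi : functional_subspace psi -> functional_subspace (act_s e psi).
Proof.
move=> [p0 pS]; split=> [[[v [|f l]] q] ns|[[v [|f m]] q] l vs sl l0] /=.
- case: eqP => //= vE; subst v; apply: p0 => /valid_cons vq; apply: ns.
  exact: (proj1 (proj1 (valid_shift1 ((src e, [::]), q) e) vq)).
- case: ifP => //= /andP[/eqP vE /eqP fe]; subst; apply: p0 => vq; apply: ns.
  exact/valid_cons.
(* For a trivial first path only the edge [e] contributes to the sum, reflecting that e^* times the
   sum of all f f^* is e^*. *)
- have [ul lE] := proj1 (enum_srcP _ _) sl.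
  have := lE e; rewrite /prng /= eq_sym => <-.
  case: ifP => el; last by rewrite big1.
  rewrite (bigD1_seq e) //= eqxx big1 ?addr0 //.
  by move=> f /negbTE->.
- case: ifP => [/andP[/eqP vE /eqP fe]|_]; last by rewrite big1.
  by subst; apply: (pS ((_, _), q)) => //; exact/valid_cons.
Qed.

Lemma act_v_linear w a psi chi :
  act_v w (a *: psi + chi) = a *: act_v w psi + act_v w chi.
Proof.
apply/funext => -[[p q]|] //=; rewrite !fctE /=; case: ifP => // _.
by rewrite scaler0 addr0.
Qed.

Lemma act_e_linear e a psi chi :
  act_e e (a *: psi + chi) = a *: act_e e psi + act_e e chi.
Proof.
apply/funext => -[[p q]|] //=; rewrite !fctE /=; case: ifP => // _.
by rewrite scaler0 addr0.
Qed.

Lemma act_s_linear e a psi chi :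
  act_s e (a *: psi + chi) = a *: act_s e psi + act_s e chi.
Proof.
apply/funext => -[[[v [|f l]] q]|] //=; rewrite !fctE /=; case: ifP => // _;
by rewrite scaler0 addr0.
Qed.

Section Lift.
Variable f : (index -> M) -> (index -> M).
Hypothesis f_stable : forall psi, functional_subspace psi -> functional_subspace (f psi).
Hypothesis f_linear : forall a psi chi, f (a *: psi + chi) = a *: f psi + f chi.

Definition lift_endo : endo_op (functional : lmodType K).
Proof.
apply: (@ss_in _ _ (linear_subspace functional)
  (fun x => ss_in (f_stable (ss_valS x)))).
by move=> a x y; apply: ss_val_inj => /=; rewrite -f_linear.
Defined.
End Lift.

Definition rep_v w := lift_endo (@act_v_stable w) (@act_v_linear w).
Definition rep_e e := lift_endo (@act_e_stable e) (@act_e_linear e).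
Definition rep_s e := lift_endo (@act_s_stable e) (@act_s_linear e).

Definition eval (x : endo_op (functional : lmodType K)) (psi : functional)
  (i : index) : M := ss_val (ss_val (x : endo (functional : lmodType K)) psi) i.

Lemma eval_inj x y : (forall psi i, eval x psi i = eval y psi i) -> x = y.
Proof.
move=> H; apply: ss_val_inj; apply/funext => psi; apply: ss_val_inj.
by apply/funext => i; exact: H.
Qed.

Lemma eval0 psi i : eval 0 psi i = 0. Proof. by []. Qed.

Lemma evalD x y psi i : eval (x + y) psi i = eval x psi i + eval y psi i.
Proof.
rewrite /eval (ss_valD (x : endo _) (y : endo _)) addrfctE ss_valD.
by rewrite addrfctE.
Qed.

Lemma evalZ a x psi i : eval (a *: x) psi i = a *: eval x psi i.
Proof.
rewrite /eval (ss_valZ a (x : endo _)) scalrfctE ss_valZ.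
by rewrite scalrfctE.
Qed.

Lemma eval_sum I (r : seq I) F psi i :
  eval (\sum_(j <- r) F j) psi i = \sum_(j <- r) eval (F j) psi i.
Proof.
exact: (big_morph (fun x => eval x psi i) (fun x y => evalD x y psi i) (eval0 psi i)).
Qed.

(** Transposition reverses products and [endo_op] reverses them back, so the relations can be
    compared value by value. Most hold by computation on indices; (CK2) uses the two conditions
    defining functionals. *)
Lemma rep_family : leavitt_family rep_v rep_e rep_s.
Proof.
do !split.
- move=> v; apply: eval_inj => psi [[p q]|] /=; rewrite /eval /= ?eqxx //.
  by case: eqP.
- move=> v w vw; apply: eval_inj => psi [[p q]|]; rewrite eval0 /eval /=.
    by do 2 case: eqP => //; move=> -> wv; case: vw.
  by case: eqP => // wv; case: vw.
- move=> e; apply: eval_inj => psi [[p q]|]; rewrite /eval /= ?eqxx //.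
- move=> e; apply: eval_inj => psi [[p q]|]; rewrite /eval /= ?eqxx //.
  by case: eqP.
- move=> e; apply: eval_inj => psi [[[v [|f l]] q]|]; rewrite /eval /= ?eqxx //.
- move=> e; apply: eval_inj => psi [[[v [|f l]] q]|]; rewrite /eval /= ?eqxx //.
    by case: eqP.
  by case: eqP.
- move=> e; apply: eval_inj => psi [[[v l] q]|]; rewrite /eval /= ?eqxx //.
  by case: eqP => //= ->.
- move=> e f ef; apply: eval_inj => psi [[[v l] q]|]; rewrite eval0 /eval /=;
  by rewrite (_ : f == e = false) ?andbF ?if_same //; apply/eqP => /esym.
- move=> v l vl l0; apply: eval_inj => psi i; rewrite eval_sum /eval /=.
  have [p0 pS] := ss_valS psi; have [ul lE] := proj1 (enum_srcP _ _) vl.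
  case: i => [[[w [|f m]] q]|] /=.
  + under eq_bigr do rewrite eqxx.
    case: eqP => [wv|wv]; last first.
      rewrite big_seq big1 // => e; rewrite lE => /eqP ev.
      by case: eqP => // wE; case: wv; rewrite wE.
    subst w; have -> : \sum_(e <- l)
        (if v == src e
         then ss_val psi (Some (src e, [:: e], (q.1, q.2 ++ [:: e]))) else 0)
      = \sum_(e <- l) ss_val psi (Some (shift ((v, [::]), q) [:: e])).
      by rewrite big_seq [RHS]big_seq; apply: eq_bigr => e; rewrite lE => /eqP->;
         rewrite eqxx.
    (* On an invalid pair both sides vanish, since none of its shifts is valid. *)
    case: (pselect (valid ((v, [::]), q))) => [vq|nv]; first exact: pS.
    rewrite p0 // big1 // => e _; apply: p0 => /valid_shift1[vq _].
    by apply: nv.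
  + under eq_bigr do rewrite eqxx.
    have [fl|fl] := boolP (f \in l).
      have := lE f; rewrite fl => /esym/eqP fv.
      rewrite (bigD1_seq f) //= eqxx andbT big1 ?addr0 ?fv.
        by case: eqP => // ->.
      by move=> e ef; rewrite [f == e]eq_sym (negbTE ef) andbF.
    (* If [f] is not an edge out of [v], a path from [v] cannot begin with it: the pair is invalid
       and its value is 0. *)
    rewrite [RHS]big_seq [RHS]big1.
      case: eqP => // wv; apply: p0 => -[[/= fw _] _].
      by move: fl; rewrite lE fw wv eqxx.
    by move=> e el; case: (f =P e) => [fe|]; rewrite ?andbF //;
       rewrite fe el in fl.
  + rewrite (pS _ l) //= big_seq [RHS]big_seq; apply: eq_bigr => e.
    by rewrite lE eqxx => /eqP->.
Qed.

End Functional.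

Section LPATheory.
Variables (K : fieldType) (sig : K -> K) (E : graph) (L : LPA sig E).

Lemma pval_rcons v l e : pval L (v, rcons l e) = pval L (v, l) ** le L e.
Proof. by rewrite /pval /= -cats1 foldl_cat. Qed.

Lemma star_pval_rcons v l e :
  ia_star (pval L (v, rcons l e)) = ls L e ** ia_star (pval L (v, l)).
Proof. by rewrite pval_rcons ia_starM lpa_star_e. Qed.

(* The transpose of left multiplication makes the linear forms on L a right
   L-module, and a linear form is recovered by evaluating this action at 1. *)
Lemma lpa_functional (M : lmodType K) (phi : path E * path E -> M) :
    (forall s l, valid s -> enum_src (prng s.1) l -> l <> [::] ->
       phi s = \sum_(e <- l) phi (shift s [:: e])) ->
  exists t : L -> M,
    [/\ forall x y, t (x + y) = t x + t y,
        forall a x, t (a *: x) = a *: t x &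
        forall s, valid s -> t (pval L s.1 ** ia_star (pval L s.2)) = phi s].
Proof.
move=> phiS; have [rho [[rD [rZ rM]] [rv [re rs]]]] := lpa_univ L (@rep_family K E M).
(* The value at 1 is subject to no condition and is set to 0. *)
have : functional_subspace E M
    (fun i => if i is Some s then if pselect (valid s) then phi s else 0 else 0).
  split=> [s ns|s l vs sl l0]; first by case: pselect.
  case: (pselect (valid s)) => [vs'|/(_ vs)//].
  rewrite (phiS _ _ vs sl l0) big_seq [RHS]big_seq.
  apply: eq_bigr => e el; case: pselect => // -[].
  apply/valid_shift1; split=> //.
  by have [_ /(_ e)] := proj1 (enum_srcP _ _) sl; rewrite el => /esym/eqP.
move=> Phi_ok; pose Phi := ss_in Phi_ok.
have evalM x y psi i : eval (rho (x ** y)) psi i = eval (rho y) (ss_val (rho x) psi) i.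
  by rewrite rM.
(* The suffix [m] is kept general because the induction moves the last edge of [l] to the front of
   [m]. *)
have eval_pval v l m q psi : chain v l ->
    eval (rho (pval L (v, l))) psi (Some ((prng (v, l), m), q)) =
    ss_val psi (Some ((v, l ++ m), q)).
  elim/last_ind: l m => [|l e IHl] m; first by rewrite rv /eval /= eqxx.
  rewrite -{1}cats1 chain_cat /= => -[vl [se _]].
  rewrite pval_rcons evalM re /eval /= -cats1 prng_cat /= eqxx.
  by rewrite se -[LHS]/(eval _ _ _) IHl // -catA.
have eval_star v l psi : chain v l ->
    eval (rho (ia_star (pval L (v, l)))) psi None =
    ss_val psi (Some ((prng (v, l), [::]), (v, l))).
  elim/last_ind: l psi => [|l e IHl] psi; first by rewrite lpa_star_v rv.
  rewrite -{1}cats1 chain_cat /= => -[vl [se _]].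
  by rewrite star_pval_rcons evalM IHl // rs /= se eqxx -cats1 prng_cat.
exists (fun x => eval (rho x) Phi None); split.
- by move=> x y; rewrite rD evalD.
- by move=> a x; rewrite rZ evalZ.
- move=> [[v l] [w m]] vs; have [/= pv [qv pq]] := vs.
  rewrite evalM eval_star // -pq -[LHS]/(eval _ _ _) eval_pval // cats0 /=.
  by case: pselect.
Qed.

End LPATheory.

(** * Spanning elements and the trace property *)

Section SpanningSet.
Variables (K : fieldType) (sig : {rmorphism K -> K}) (E : graph) (L : LPA sig E).

(** [P] cuts out a subalgebra containing the generators. The universal property maps [L] into it,
    and by uniqueness this map followed by the inclusion is the identity. *)
Lemma lpa_ind (P : L -> Prop) :
    P 0 -> (forall x y, P x -> P y -> P (x + y)) ->
    (forall a x, P x -> P (a *: x)) ->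
    (forall x y, P x -> P y -> P (x ** y)) ->
    (forall v, P (lv L v)) -> (forall e, P (le L e)) -> (forall e, P (ls L e)) ->
  forall x, P x.
Proof.
move=> P0 PD PZ PM Pv Pe Ps.
have PZD a x y : P x -> P y -> P (a *: x + y) by move=> Px Py; apply/PD/Py/PZ.
pose S := @Subspace K L P P0 PZD.
have SM : forall x y, S x -> S y -> S (x ** y) := PM.
pose fv v := ss_in (Pv v : S _) : subalg SM.
pose fe e := ss_in (Pe e : S _) : subalg SM.
pose fs e := ss_in (Ps e : S _) : subalg SM.
have fam : leavitt_family fv fe fs.
  have [H1 [H2 [H3 [H4 [H5 [H6 [H7 [H8 H9]]]]]]]] := lpa_family L.
  do !split.
  - by move=> v; apply: ss_val_inj; exact: H1.
  - by move=> v w vw; apply: ss_val_inj; exact: H2.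
  - by move=> e; apply: ss_val_inj; exact: H3.
  - by move=> e; apply: ss_val_inj; exact: H4.
  - by move=> e; apply: ss_val_inj; exact: H5.
  - by move=> e; apply: ss_val_inj; exact: H6.
  - by move=> e; apply: ss_val_inj; exact: H7.
  - by move=> e f ef; apply: ss_val_inj; exact: H8.
  - move=> v l vl l0; apply: ss_val_inj; rewrite (additive_sum (@ss_valD _ _ S)).
    exact: H9.
have [f [[fD [fZ fM]] [fvE [feE fsE]]]] := lpa_univ L fam.
move=> x; suff <- : ss_val (f x : ss_sort S) = x by exact: (ss_valS (f x : ss_sort S)).
apply: (@lpa_uniq _ _ _ L L (fun x => ss_val (f x : ss_sort S)) id) => [|//|v|e|e].
- split=> [y z|]; first by rewrite fD.
  by split=> [a y|y z]; [rewrite fZ|rewrite fM].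
- by rewrite fvE.
- by rewrite feE.
- by rewrite fsE.
Qed.

Lemma star_if (b : bool) (x : L) :
  ia_star (if b then x else 0) = if b then ia_star x else 0.
Proof. exact: (additive_if (@ia_starD _ _ L)). Qed.

Lemma lv_mul v w : lv L v ** lv L w = if v == w then lv L v else 0.
Proof.
have [H1 [H2 _]] := lpa_family L.
by case: eqP => [->|/H2].
Qed.

Lemma lv_le e : lv L (src e) ** le L e = le L e.
Proof. by have [_ [_ [H _]]] := lpa_family L. Qed.

Lemma le_lv e : le L e ** lv L (rng e) = le L e.
Proof. by have [_ [_ [_ [H _]]]] := lpa_family L. Qed.

Lemma ls_lv e : ls L e ** lv L (src e) = ls L e.
Proof. by have [_ [_ [_ [_ [_ [H _]]]]]] := lpa_family L. Qed.

Lemma ls_le e f : ls L e ** le L f = if e == f then lv L (rng e) else 0.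
Proof.
have [_ [_ [_ [_ [_ [_ [H7 [H8 _]]]]]]]] := lpa_family L.
by case: eqP => [<-|/H8].
Qed.

Lemma lpa_CK2 v l : enum_src v l -> l <> [::] ->
  lv L v = \sum_(e <- l) le L e ** ls L e.
Proof. by have [_ [_ [_ [_ [_ [_ [_ [_ H]]]]]]]] := lpa_family L; exact: H. Qed.

Lemma foldl_le (x y : L) l :
  foldl (fun x e => x ** le L e) (x ** y) l = x ** foldl (fun x e => x ** le L e) y l.
Proof. by elim: l x y => //= e l IHl x y; rewrite -ka_mulA IHl. Qed.

Lemma pval_cons e l : pval L (src e, e :: l) = le L e ** pval L (rng e, l).
Proof. by rewrite /pval /= lv_le -{1}le_lv foldl_le. Qed.

Lemma lv_pval w p : lv L w ** pval L p = if p.1 == w then pval L p else 0.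
Proof.
rewrite /pval -foldl_le lv_mul eq_sym; case: eqP => [->//|_].
by elim: p.2 => //= e l; rewrite ka_mul0l.
Qed.

Lemma pval_lv p w : is_path p ->
  pval L p ** lv L w = if prng p == w then pval L p else 0.
Proof.
case: p => v l; rewrite /is_path /=; case/lastP: l => [|l e] _; first exact: lv_mul.
rewrite pval_rcons -ka_mulA -cats1 prng_cat -{1}le_lv -ka_mulA lv_mul /prng /=.
by case: eqP => _; rewrite ?le_lv // ka_mul0r ka_mul0r.
Qed.

Definition ev (s : path E * path E) : L := pval L s.1 ** ia_star (pval L s.2).

Lemma star_ev s : ia_star (ev s) = ev (s.2, s.1).
Proof. by rewrite ia_starM ia_starK. Qed.

Lemma ev_vertex v : ev ((v, [::]), (v, [::])) = lv L v.
Proof. by rewrite /ev /pval /= lpa_star_v lv_mul eqxx. Qed.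

(** Left multiplication by a generator sends p q^* to an element of the same form or to 0. The
    formulas from here to [ls_ev_cons] mirror [act_v], [act_e] and [act_s]. *)
Lemma lv_ev w s : lv L w ** ev s = if s.1.1 == w then ev s else 0.
Proof. by rewrite /ev ka_mulA lv_pval; case: ifP; rewrite ?ka_mul0l. Qed.

Lemma le_ev e s :
  le L e ** ev s =
  if s.1.1 == rng e then ev ((src e, e :: s.1.2), s.2) else 0.
Proof.
case: s => -[v l] q; rewrite /ev /= ka_mulA; case: eqP => [->|/eqP vE].
  by rewrite pval_cons.
by rewrite -{1}le_lv -(ka_mulA (le L e)) lv_pval (negbTE vE) ka_mul0r ka_mul0l.
Qed.

Lemma ls_ev_nil e v q : is_path q -> prng q = v ->
  ls L e ** ev ((v, [::]), q) =
  if v == src e then ev ((rng e, [::]), (q.1, q.2 ++ [:: e])) else 0.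
Proof.
move=> qP qv; rewrite /ev /= ka_mulA.
rewrite -{1}ls_lv -(ka_mulA (ls L e)) /pval /= lv_mul eq_sym; case: eqP => [_|_]; last first.
  by rewrite ka_mul0r ka_mul0l.
case: q {qP qv} => w m /=; rewrite ls_lv -/(pval L (w, m)).
rewrite -/(pval L (w, m ++ [:: e])) cats1 pval_rcons ia_starM lpa_star_e.
by rewrite ka_mulA; congr (_ ** _); have [_ [_ [_ [_ [-> _]]]]] := lpa_family L.
Qed.

Lemma ls_ev_cons e v f l q : src f = v ->
  ls L e ** ev ((v, f :: l), q) = if f == e then ev ((rng e, l), q) else 0.
Proof.
move=> <-; rewrite /ev /= pval_cons !ka_mulA ls_le eq_sym; case: eqP => [->|_].
  by rewrite lv_pval eqxx.
by rewrite !ka_mul0l.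
Qed.

Inductive span : L -> Prop :=
| span0 : span 0
| spanZD a s x of valid s & span x : span (a *: ev s + x).

Lemma span_ev a s : valid s -> span (a *: ev s).
Proof. by move=> vs; rewrite -[_ *: _]addr0; apply: (spanZD _ vs span0). Qed.

Lemma spanD x y : span x -> span y -> span (x + y).
Proof.
elim=> [|a s z vs _ IH] sy; first by rewrite add0r.
by rewrite -addrA; constructor => //; apply: IH.
Qed.

Lemma spanZ a x : span x -> span (a *: x).
Proof.
elim=> [|b s z vs _ IH]; first by rewrite scaler0; constructor.
by rewrite scalerDr scalerA; constructor.
Qed.

Lemma valid_sym (s : path E * path E) : valid s -> valid (s.2, s.1).
Proof. by case=> [? [? ?]]. Qed.

Lemma lv_span w s : valid s -> span (lv L w ** ev s).
Proof.
move=> vs; rewrite lv_ev; case: ifP => _; last exact: span0.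
by rewrite -[ev s]scale1r; apply: span_ev.
Qed.

Lemma le_span e s : valid s -> span (le L e ** ev s).
Proof.
case: s => -[v l] q vs; rewrite le_ev /=; case: eqP => [vE|_]; last exact: span0.
by rewrite -[ev _]scale1r; apply: span_ev; apply/valid_cons; rewrite -vE.
Qed.

Lemma ls_span e s : valid s -> span (ls L e ** ev s).
Proof.
case: s => -[v [|f l]] q vs; have [pP [qP pq]] := vs.
  rewrite ls_ev_nil //; case: eqP => [vE|_]; last exact: span0.
  rewrite -[ev _]scale1r; apply: span_ev; apply/valid_cons.
  by rewrite vE in vs pq; exact/(valid_shift1 ((src e, [::]), q)).
have [/= sf _] := pP; rewrite ls_ev_cons //; case: eqP => [fe|_]; last exact: span0.
rewrite -[ev _]scale1r; apply: span_ev; rewrite -fe; apply/valid_cons.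
by rewrite sf.
Qed.

(** The induction carries the stronger claim that left multiplication by [x] preserves the span,
    which settles products at once. *)
Lemma lpa_span x : span x.
Proof.
suff: span x /\ forall y, span y -> span (x ** y) by case.
have gen (g : L) : span g -> (forall s, valid s -> span (g ** ev s)) ->
    span g /\ forall y, span y -> span (g ** y).
  move=> sg H; split=> // y; elim=> [|a s z vs _ IH].
    by rewrite ka_mul0r; constructor.
  by rewrite ka_mulDr ka_mulZr; apply: spanD => //; apply/spanZ/H.
have v0 v : valid ((v, [::]), (v, [::]) : path E) by [].
move: x; apply: lpa_ind.
- by split; [constructor|move=> y _; rewrite ka_mul0l; constructor].
- move=> x y [sx xP] [sy yP]; split=> [|z sz]; first exact: spanD.
  by rewrite ka_mulDl; apply: spanD; [apply: xP|apply: yP].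
- move=> a x [sx xP]; split=> [|z sz]; first exact: spanZ.
  by rewrite ka_mulZl; apply/spanZ/xP.
- move=> x y [sx xP] [sy yP]; split=> [|z sz]; first exact: xP.
  by rewrite -ka_mulA; apply/xP/yP.
- move=> v; apply: gen => [|s]; last exact: lv_span.
  by rewrite -ev_vertex -[ev _]scale1r; apply: span_ev.
- move=> e; apply: gen => [|s]; last exact: le_span.
  (* Writing e = e r(e) turns the generator into a product with a spanning element. *)
  by rewrite -le_lv -ev_vertex; apply: le_span.
- move=> e; apply: gen => [|s]; last exact: ls_span.
  by rewrite -ls_lv -ev_vertex; apply: ls_span.
Qed.

Section Trace.
Variables (R : kAlg K) (d : vert E -> R) (t : L -> R).
Hypothesis tD : forall x y, t (x + y) = t x + t y.
Hypothesis tZ : forall a x, t (a *: x) = a *: t x.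
Hypothesis t_ev : forall s, valid s -> t (ev s) = if s.1 == s.2 then d (prng s.1) else 0.

(** The prescribed value is symmetric in p and q. As [t] is linear and the star conjugate-linear,
    the claim is restricted to spanning elements. *)
Lemma t_star_ev s : valid s -> t (ia_star (ev s)) = t (ev s).
Proof.
move=> vs; rewrite star_ev !t_ev //=; last exact: valid_sym.
by rewrite eq_sym; case: eqP => // ->.
Qed.

Lemma t_star_le_ev e s : valid s -> t (ia_star (le L e ** ev s)) = t (le L e ** ev s).
Proof.
case: s => -[v l] q vs; rewrite le_ev star_if !(additive_if tD).
case: eqP => //= vE; apply: t_star_ev; apply/valid_cons; by rewrite -vE.
Qed.

Lemma t_star_ls_ev e s : valid s -> t (ia_star (ls L e ** ev s)) = t (ls L e ** ev s).
Proof.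
case: s => -[v [|f l]] q vs; have [pP [qP pq]] := vs.
  rewrite ls_ev_nil // star_if !(additive_if tD); case: eqP => // vE.
  apply: t_star_ev; apply/valid_cons; rewrite vE in vs pq.
  exact/(valid_shift1 ((src e, [::]), q)).
have [/= sf _] := pP; rewrite ls_ev_cons // star_if !(additive_if tD).
case: eqP => // fe; apply: t_star_ev; rewrite -fe; apply/valid_cons.
by rewrite sf.
Qed.

(** For s = (p, q), both sides equal [d (prng q)] if q = ep, and 0 otherwise. *)
Lemma t_le_ev e s : valid s -> t (le L e ** ev s) = t (ls L e ** ev (s.2, s.1)).
Proof.
case: s => [[v l] [w m]] vs; rewrite le_ev (additive_if tD) /=.
have -> : (if v == rng e then t (ev ((src e, e :: l), (w, m))) else 0) =
    if (v == rng e) && ((src e, e :: l) == (w, m)) then d (prng (w, m)) else 0.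
  case: eqP => //= vE; rewrite t_ev; last by apply/valid_cons; rewrite -vE.
  by case: eqP => //= ->.
have [/= _ [qP pq]] := vs; case: m vs qP pq => [|f m] vs qP pq.
  rewrite xpair_eqE !andbF ls_ev_nil //; last by case: vs.
  rewrite (additive_if tD); case: eqP => // wE.
  rewrite t_ev /=; first by case: eqP => // -[_]; case: (l).
  apply/valid_cons/(valid_shift1 ((src e, [::]), (v, l))).
  by rewrite -wE; split=> //; exact: (valid_sym vs).
have [/= fw _] := qP; rewrite ls_ev_cons // (additive_if tD).
case: (f =P e) => [fe|ne]; last first.
  by rewrite (_ : _ && _ = false) //; apply/negP => /andP[_ /eqP[_ ef _]]; case: ne.
subst f w; rewrite t_ev; last by apply/valid_cons; exact: (valid_sym vs).
rewrite /= !xpair_eqE eqseq_cons !eqxx /= !(eq_sym v) (eq_sym l).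
by [].
Qed.

(** The right side of the hypothesis is the value of [t] at p q^* g: the star converts right
    multiplication by [g] into left multiplication, for which explicit formulas exist. *)
Lemma t_comm_gen (g : L) :
    (forall s, valid s -> t (g ** ev s) = t (ia_star (ia_star g ** ev (s.2, s.1)))) ->
  forall y, t (g ** y) = t (y ** g).
Proof.
move=> H y; elim: (lpa_span y) => [|a s z vs _ IH].
  by rewrite ka_mul0l ka_mul0r.
rewrite ka_mulDl ka_mulDr !tD IH ka_mulZl ka_mulZr !tZ; congr (_ *: _ + _).
by rewrite H // ia_starM -star_ev !ia_starK.
Qed.

(** The x with t(xy) = t(yx) for all y form a subalgebra, because t(xyz) = t(yzx) = t(zxy); hence
    generators suffice. *)
Lemma t_trace : is_trace t.
Proof.
split=> // x; move: x; apply: lpa_ind.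
- by move=> y; rewrite ka_mul0l ka_mul0r.
- by move=> x y xP yP z; rewrite ka_mulDl ka_mulDr !tD xP yP.
- by move=> a x xP y; rewrite ka_mulZl ka_mulZr !tZ xP.
- by move=> x y xP yP z; rewrite -ka_mulA xP -ka_mulA yP ka_mulA.
- move=> v; apply: t_comm_gen => s vs; rewrite lpa_star_v !lv_ev star_if.
  rewrite !(additive_if tD) t_star_ev; last exact: valid_sym.
  rewrite !t_ev //=; last exact: valid_sym.
  by rewrite (eq_sym s.2); case: (s.1 =P s.2) => [->//|_]; rewrite !if_same.
- move=> e; apply: t_comm_gen => s vs; rewrite lpa_star_e t_star_ls_ev ?t_le_ev //.
  exact: valid_sym.
- move=> e; apply: t_comm_gen => s vs; rewrite lpa_star_s t_star_le_ev.
    by rewrite t_le_ev -?surjective_pairing //; exact: valid_sym.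
  exact: valid_sym.
Qed.

End Trace.

End SpanningSet.

(** * The forest of pairs of paths *)

Section Forest.
Variable E : graph.
Implicit Types s n : path E * path E.

(** The candidate suffix is read off the second paths and then compared with the first ones, which
    makes the order decidable. *)
Definition pre s n : bool :=
  [&& s.1.1 == n.1.1, s.2.1 == n.2.1, prefix s.2.2 n.2.2
    & n.1.2 == s.1.2 ++ drop (size s.2.2) n.2.2].

Lemma preP s n : reflect (exists u, n = shift s u) (pre s n).
Proof.
case: s n => [[a b] [a' b']] [[v l] [v' l']]; rewrite /pre /shift /=.
apply: (iffP and4P) => [[/eqP-> /eqP-> /prefixP[u ->] /eqP->]|[u [-> -> -> ->]]].
  by exists u; rewrite drop_size_cat.
by rewrite !eqxx prefix_prefix drop_size_cat.
Qed.

Lemma shift0 s : shift s [::] = s.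
Proof. by case: s => [[a b] [a' b']]; rewrite /shift /= !cats0. Qed.

Lemma shift_shift s u u' : shift (shift s u) u' = shift s (u ++ u').
Proof. by rewrite /shift /= !catA. Qed.

Lemma shift_injr s : injective (shift s).
Proof.
move=> u u' /(congr1 (fun s => s.1.2)) /= /eqP.
by rewrite eqseq_cat // eqxx => /eqP.
Qed.

Lemma size_shift s u : size (shift s u).1.2 = (size s.1.2 + size u)%N.
Proof. by rewrite size_cat. Qed.

Lemma pre_refl s : pre s s.
Proof. by apply/preP; exists [::]; rewrite shift0. Qed.

Lemma pre_trans s n r : pre s n -> pre n r -> pre s r.
Proof.
move=> /preP[u ->] /preP[u' ->]; apply/preP; exists (u ++ u').
by rewrite shift_shift.
Qed.

Lemma pre_anti s n : pre s n -> pre n s -> s = n.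
Proof.
move=> /preP[u nE] /preP[u' sE].
have := congr1 (fun s => size s.1.2) sE; rewrite {1}nE !size_shift -{1}[size _]addn0.
rewrite -addnA => /addnI/esym/eqP; rewrite addn_eq0 => /andP[/nilP u0 _].
by rewrite nE u0 shift0.
Qed.

Definition child s n : bool := `[< exists e, n = shift s [:: e] >].

Lemma childP s n : reflect (exists e, n = shift s [:: e]) (child s n).
Proof. exact: asboolP. Qed.

Lemma child_pre s n : child s n -> pre s n.
Proof. by move/childP=> [e ->]; apply/preP; exists [:: e]. Qed.

Lemma child_Npre s n : child s n -> ~~ pre n s.
Proof.
move=> sn; apply/negP => /(pre_anti (child_pre sn)) nE.
by case/childP: sn => e /(congr1 (fun s => size s.1.2)); rewrite -nE size_shift addn1 => /n_Sn.
Qed.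

Lemma shift_eq s n u e u' : shift s (rcons u e) = shift n (rcons u' e) ->
  shift s u = shift n u'.
Proof.
case: s n => [[a b] [a' b']] [[v l] [v' l']]; rewrite /shift /= -!rcons_cat.
by case=> -> /rcons_inj[->] -> /rcons_inj[->].
Qed.

(** Removing the common last edge recovers the parent, so whatever strictly precedes [r] precedes
    its parent. This makes the order a forest. *)
Lemma pre_child s n r : child n r -> pre s r -> s = r \/ pre s n.
Proof.
move=> /childP[e ->] /preP[u]; case/lastP: u => [|u e'].
  by rewrite shift0; left.
move=> H; right; apply/preP; exists u.
have ee : e = e'.
  have /(congr1 (last e)) := congr1 (fun s => s.1.2) H.
  by rewrite /= last_cat /= -rcons_cat last_rcons.
by rewrite -ee in H; have := @shift_eq n s [::] e u H; rewrite shift0.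
Qed.

Definition down_closed (S : seq (path E * path E)) : Prop :=
  [/\ uniq S, forall s, s \in S -> valid s &
      forall s n, n \in S -> pre s n -> s \in S].

Lemma valid_pre s n : pre s n -> valid n -> valid s.
Proof.
move=> /preP[u ->]; elim/last_ind: u => [|u e IHu]; first by rewrite shift0.
by rewrite -cats1 -shift_shift => /valid_shift1[/IHu].
Qed.

Lemma pre_finite s :
  exists D : seq (path E * path E), forall n, (n \in D) = pre n s.
Proof.
(* Predecessors of [s] arise by removing the same number [k] of final edges from both paths; the
   filter discards the other truncations. *)
pose cut k := ((s.1.1, take (size s.1.2 - k) s.1.2),
                          (s.2.1, take (size s.2.2 - k) s.2.2)).
exists [seq n <- map cut (iota 0 (size s.1.2).+1) | pre n s] => n.
rewrite mem_filter; case: (boolP (pre n s)) => // /preP[u sE].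
rewrite andTb; apply/mapP; exists (size u).
  by rewrite mem_iota /= add0n ltnS sE size_shift leq_addl.
rewrite /cut sE /= !size_cat !addnK !take_size_cat //.
by case: (n) => [[? ?] [? ?]].
Qed.

Lemma down_closure (S0 : seq (path E * path E)) :
  (forall s, s \in S0 -> valid s) ->
  exists2 S, down_closed S & {subset S0 <= S}.
Proof.
elim: S0 => [|s S0 IH] vS; first by exists [::].
have [|S [uS vS' dS] S0S] := IH; first by move=> n nS; apply: vS; rewrite in_cons nS orbT.
have vs : valid s by apply: vS; rewrite mem_head.
have [D DE] := pre_finite s.
exists (undup (S ++ D)).
  split=> [|n|n r]; first exact: undup_uniq.
    rewrite mem_undup mem_cat DE => /orP[/vS'//|ns].
    exact: valid_pre ns vs.
  rewrite !mem_undup !mem_cat !DE => /orP[rS nr|rs nr].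
    by rewrite (dS n r).
  by rewrite (pre_trans nr rs) orbT.
move=> n; rewrite in_cons mem_undup mem_cat DE => /orP[/eqP->|/S0S->//].
by rewrite pre_refl orbT.
Qed.

Lemma sum_unique (T : eqType) (V : nmodType) (r : seq T) (P : pred T) (x : V) :
  uniq r -> (forall a b, a \in r -> b \in r -> P a -> P b -> a = b) ->
  \sum_(a <- r | P a) x = if has P r then x else 0.
Proof.
elim: r => [|a r IH] /=; first by rewrite big_nil.
move=> /andP[ar ur] H; rewrite big_cons IH //; last first.
  by move=> b c br cr; apply: H; rewrite in_cons ?br ?cr orbT.
case: ifP => //= Pa; case: hasP => [[b br Pb]|_]; last by rewrite addr0.
by rewrite (H a b) ?mem_head ?in_cons ?br ?orbT // in ar.
Qed.

Section DownClosed.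
Variable S : seq (path E * path E).
Hypothesis S_down : down_closed S.

(** When [n] strictly precedes [s], exactly one child of [n] precedes [s]: the next pair on the way.
    Down-closedness puts it in [S]. *)
Lemma sum_child_pre (V : nmodType) (x : V) s n : s \in S ->
  \sum_(r <- S | child n r) (if pre r s then x else 0) =
  if pre n s && (n != s) then x else 0.
Proof.
case: S_down => uS _ dS sS; rewrite -big_mkcondr sum_unique //; last first.
  move=> a b _ _ /andP[/childP[e ->] /preP[u ->]] /andP[/childP[e' ->] /preP[u']].
  by rewrite !shift_shift => /shift_injr[->].
congr (if _ then _ else _); apply/hasP/andP => [[r rS /andP[nr rs]]|[]].
  split; first exact: pre_trans (child_pre nr) rs.
  by apply: contraTneq rs => <-; apply: child_Npre.
move=> /preP[[|e u] sE]; first by rewrite sE shift0 eqxx.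
move=> _; have rs : pre (shift n [:: e]) s.
  by apply/preP; exists u; rewrite shift_shift.
exists (shift n [:: e]); first exact: dS sS rs.
by rewrite rs andbT; apply/childP; exists e.
Qed.

(** Parents are unique, and the parent of [n] comes at or after [s] exactly when [s] strictly
    precedes [n]. *)
Lemma sum_pre_parent (V : nmodType) (x : V) s n : n \in S ->
  \sum_(r <- S | child r n) (if pre s r then x else 0) =
  if pre s n && (s != n) then x else 0.
Proof.
case: S_down => uS _ dS nS; rewrite -big_mkcondr sum_unique //; last first.
  move=> a b _ _ /andP[an _] /andP[bn _].
  apply: pre_anti.
    by case: (pre_child bn (child_pre an)) => // aE; move: (child_Npre an); rewrite aE pre_refl.
  by case: (pre_child an (child_pre bn)) => // aE; move: (child_Npre bn); rewrite aE pre_refl.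
congr (if _ then _ else _); apply/hasP/andP => [[r rS /andP[rn sr]]|[]].
  split; first exact: pre_trans sr (child_pre rn).
  by apply: contraTneq sr => ->; apply: child_Npre.
move=> /preP[u]; case/lastP: u => [|u e] nE; first by rewrite nE shift0 eqxx.
move=> _; have rn : child (shift s u) n.
  by apply/childP; exists e; rewrite shift_shift cats1.
exists (shift s u); first exact: dS nS (child_pre rn).
by rewrite rn; apply/preP; exists u.
Qed.
End DownClosed.

(** Turns sums over children into sums over a finite set of edges, the form in which positivity of a
    graph trace is stated. *)
Lemma children_edges (S : seq (path E * path E)) s : uniq S ->
  exists l, [/\ uniq l, forall e, (e \in l) = (shift s [:: e] \in S) &
    forall (V : nmodType) (F : path E * path E -> V),
      \sum_(n <- S | child s n) F n = \sum_(e <- l) F (shift s [:: e])].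
Proof.
elim: S => [|n S IH] /=.
  by exists [::]; split=> // V F; rewrite !big_nil.
move=> /andP[nS /IH[l [ul lE lF]]]; case: (boolP (child s n)) => sn.
  case/childP: (sn) => e nE; exists (e :: l); split.
  - by rewrite /= ul lE -nE nS.
  - move=> f; rewrite !in_cons lE nE; congr (_ || _).
    by apply/eqP/eqP => [->//|/shift_injr[]].
  - by move=> V F; rewrite !big_cons sn lF nE.
exists l; split=> // [e|V F]; last by rewrite big_cons (negbTE sn) lF.
rewrite in_cons lE (_ : _ == n = false) //; apply/eqP => nE.
by case/negP: sn; apply/childP; exists e.
Qed.

End Forest.

(** * Nonnegative elements and positive definite involutions *)

Section Nonneg.
Variables (K : fieldType) (sig : {rmorphism K -> K}) (R : invAlg sig).
Implicit Types x y : R.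

Lemma nonneg0 : nonneg (0 : R).
Proof. by exists [::]; rewrite big_nil. Qed.

Lemma nonnegD x y : nonneg x -> nonneg y -> nonneg (x + y).
Proof. by move=> [l ->] [m ->]; exists (l ++ m); rewrite big_cat. Qed.

Lemma nonneg_sum I (r : seq I) (F : I -> R) :
  (forall i, nonneg (F i)) -> nonneg (\sum_(i <- r) F i).
Proof.
move=> H; apply: (big_ind (@nonneg K sig R)) => //; first exact: nonneg0.
exact: nonnegD.
Qed.

Lemma nonneg_scale a x : nonneg x -> nonneg ((a * sig a) *: x).
Proof.
move=> [l ->]; exists [seq a *: z | z <- l]; rewrite big_map scaler_sumr.
by apply: eq_bigr => z _; rewrite ia_starZ ka_mulZl ka_mulZr scalerA.
Qed.

(** Concatenating the two lists gives a vanishing sum of terms z z^*, so every z is 0. *)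
Lemma posdef_nonnegD x y : posdef R -> nonneg x -> nonneg y -> x + y = 0 -> x = 0.
Proof.
move=> Rpd [l ->] [m ->] lm0.
have /Rpd H : \sum_(z <- l ++ m) z ** ia_star z = 0 by rewrite big_cat.
rewrite big_seq big1 // => z zl; rewrite (H z) ?ka_mul0l //.
by rewrite mem_cat zl.
Qed.

Lemma posdef_nonneg_sum (I : eqType) (r : seq I) (F : I -> R) : posdef R ->
  (forall i, i \in r -> nonneg (F i)) -> \sum_(i <- r) F i = 0 ->
  forall i, i \in r -> F i = 0.
Proof.
move=> Rpd; elim: r => [|j r IH] //= H; rewrite big_cons => Fr.
have Hr i : i \in r -> nonneg (F i) by move=> ir; apply: H; rewrite in_cons ir orbT.
have sr : nonneg (\sum_(i <- r) F i).
  rewrite big_seq; apply: (big_ind (@nonneg K sig R)) => //; [exact: nonneg0|exact: nonnegD].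
have Fj := posdef_nonnegD Rpd (H j (mem_head _ _)) sr Fr.
move=> i; rewrite in_cons => /orP[/eqP->//|]; apply: IH => //.
by rewrite Fj add0r in Fr.
Qed.
End Nonneg.

(** * Orthogonal decomposition and positivity *)

Section Gram.
Variables (K : fieldType) (sig : {rmorphism K -> K}) (E : graph) (L : LPA sig E).
Variables (R : invAlg sig) (d : vert E -> R) (t : L -> R).
Hypothesis tD : forall x y, t (x + y) = t x + t y.
Hypothesis tZ : forall a x, t (a *: x) = a *: t x.
Hypothesis t_ev : forall s, valid s ->
  t (ev L s) = if s.1 == s.2 then d (prng s.1) else 0.

(** (CK1) cancels the common initial edges; the product vanishes as soon as two edges differ. *)
Lemma star_pval_mul v l m : chain v l -> chain v m ->
  ia_star (pval L (v, l)) ** pval L (v, m) =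
  if prefix l m then pval L (prng (v, l), drop (size l) m)
  else if prefix m l then ia_star (pval L (prng (v, m), drop (size m) l)) else 0.
Proof.
elim: l v m => [|e l IH] v m vl vm.
  by rewrite prefix0s drop0 /pval /= lpa_star_v -/(pval L (v, m)) lv_pval eqxx.
case: m vm => [|f m] vm.
  have -> : pval L (v, [::]) = ia_star (lv L v) by rewrite lpa_star_v.
  by rewrite -ia_starM lv_pval eqxx.
case: vl vm => [/= se el] [sf fm]; rewrite -{1}se -{1}sf !pval_cons ia_starM lpa_star_e.
rewrite -ka_mulA (ka_mulA (ls L e)) ls_le (eq_sym f); case: (e =P f) => [ef|_] /=; last first.
  by rewrite ka_mul0l ka_mul0r.
by subst f; rewrite lv_pval eqxx IH.
Qed.

Lemma star_pval_mul_neq p q : p.1 != q.1 -> ia_star (pval L p) ** pval L q = 0.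
Proof.
move=> /negbTE pq.
have -> : pval L p = lv L p.1 ** pval L p by rewrite lv_pval eqxx.
by rewrite ia_starM lpa_star_v -ka_mulA lv_pval eq_sym pq ka_mul0r.
Qed.

Lemma pval_cat v l m : pval L (v, l ++ m) = pval L (v, l) ** pval L (prng (v, l), m).
Proof.
elim/last_ind: m => [|m e IH]; last by rewrite -rcons_cat !pval_rcons IH ka_mulA.
rewrite cats0; case/lastP: l => [|l e]; first by rewrite /pval /= lv_mul eqxx.
by rewrite pval_rcons -ka_mulA -cats1 prng_cat /pval /= le_lv.
Qed.

(** For s = (p, q) and n = (p', q') the product is p q^* q' p'^*. If q' = qu it equals pu p'^*,
    whose trace is 0 unless p' = pu, that is, unless n is the shift of s by u. The case q = q'u is
    symmetric. *)
Lemma gram s n : valid s -> valid n ->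
  t (ev L s ** ia_star (ev L n)) =
  if pre s n then d (prng n.1) else if pre n s then d (prng s.1) else 0.
Proof.
case: s n => [[a b] [v l]] [[a' b'] [v' l']] vs vn.
have [/= vb [vl vbl]] := vs; have [/= vb' [vl' vbl']] := vn.
rewrite star_ev /ev /= -ka_mulA (ka_mulA (ia_star _)) /pre /=.
have [vv|vv] := eqVneq v v'; last first.
  by rewrite star_pval_mul_neq // ka_mul0l ka_mul0r (additive0 tD) !andbF.
subst v'; rewrite star_pval_mul // !andTb.
have [/prefixP[u lE]|pl] := boolP (prefix l l').
  subst l'; rewrite drop_size_cat // ka_mulA -vbl -pval_cat.
  have vs' : valid ((a, b ++ u), (a', b')).
    have [_ vu] := proj1 (chain_cat _ _ _) vl'.
    split=> //=; first by apply/chain_cat; rewrite vbl.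
    by split; rewrite // prng_cat vbl vbl' prng_cat.
  rewrite -[X in t X]/(ev L ((a, b ++ u), (a', b'))) t_ev //= xpair_eqE.
  have [aa|//] := eqVneq a a'; subst a'; rewrite !andTb.
  have [->|bu] := eqVneq b' (b ++ u); first by rewrite prng_cat.
  (* Here [l ++ u] would also be a prefix of [l], so [u] is empty and [b'] equals [b ++ u] after
     all. *)
  case: ifP => // /andP[/prefixP[u' lE] /eqP bE]; case/eqP: bu.
  move: lE => /(congr1 size); rewrite !size_cat -addnA -{1}[size l]addn0 => /addnI/esym/eqP.
  rewrite addn_eq0 !size_eq0 => /andP[/eqP u0 _].
  by rewrite bE u0 !cats0 drop_size cats0.
rewrite andbF /=; have [/prefixP[u lE]|_] := boolP (prefix l' l); last first.
  by rewrite andbF ka_mul0l ka_mul0r (additive0 tD).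
subst l; rewrite drop_size_cat // -ia_starM -vbl' -pval_cat.
have vs' : valid ((a, b), (a', b' ++ u)).
  have [_ vu] := proj1 (chain_cat _ _ _) vl.
  split=> //=; split=> //; first by apply/chain_cat; rewrite vbl'.
  by rewrite prng_cat vbl vbl' prng_cat.
rewrite -[X in t X]/(ev L ((a, b), (a', b' ++ u))) t_ev //= xpair_eqE (eq_sym a).
by [].
Qed.

Lemma gram_pre s n : valid s -> valid n -> pre n s ->
  t (ev L s ** ia_star (ev L n)) = d (prng s.1).
Proof.
move=> vs vn ns; rewrite gram // ns; case: ifP => // sn.
by rewrite (pre_anti sn ns).
Qed.

Section DownClosed.
Variable S : seq (path E * path E).
Hypothesis S_down : down_closed S.

(* The elements [atom s] are pairwise orthogonal: they correspond to the pieces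
   into which the cylinder sets of the pairs in [S] cut the path space. *)
Definition atom s : L := ev L s - \sum_(n <- S | child s n) ev L n.
Definition mass s : R := d (prng s.1) - \sum_(n <- S | child s n) d (prng n.1).

(** The sum telescopes: every [n] strictly beyond [s] occurs once in its own atom and once, with the
    opposite sign, in the atom of its parent. *)
Lemma ev_atoms s : s \in S ->
  ev L s = \sum_(n <- S) (if pre s n then atom n else 0).
Proof.
move=> sS; have [uS _ _] := S_down.
have -> : \sum_(n <- S) (if pre s n then atom n else 0) =
    \sum_(n <- S) (if pre s n then ev L n else 0)
    - \sum_(n <- S) \sum_(r <- S | child n r) (if pre s n then ev L r else 0).
  rewrite -sumrB; apply: eq_bigr => n _; case: ifP => // _.
  by rewrite big1 ?subr0.
under [X in _ - X]eq_bigr do rewrite big_mkcond.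
rewrite exchange_big -sumrB /=.
rewrite (eq_big_seq (fun n => if n == s then ev L n else 0)).
  by rewrite (bigD1_seq s) //= eqxx big1 ?addr0 // => n /negbTE->.
move=> n nS; rewrite -big_mkcond (sum_pre_parent S_down) //.
have [->|ns] := eqVneq n s; first by rewrite andbF pre_refl subr0.
by rewrite andbT subrr.
Qed.

(** If [n] precedes [s], it precedes all children of [s], and the pairings add up to the mass. If
    [n] lies strictly beyond [s], the one child of [s] preceding [n] cancels the term of [s]. For
    incomparable pairs every term is 0. *)
Lemma atom_ev s n : s \in S -> n \in S ->
  t (atom s ** ia_star (ev L n)) = if pre n s then mass s else 0.
Proof.
move=> sS nS; have [_ vS _] := S_down.
rewrite /atom ka_mulBl ka_mul_suml (additiveB tD) (additive_sum tD).
case: ifP => [ns|Nns].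
  rewrite gram_pre; try exact: vS; rewrite // /mass; congr (_ - _).
  rewrite big_seq_cond [RHS]big_seq_cond; apply: eq_bigr => r /andP[rS sr].
  by rewrite gram_pre; try exact: vS; rewrite // (pre_trans ns (child_pre sr)).
rewrite (_ : \sum_(r <- S | child s r) _ =
    \sum_(r <- S | child s r) (if pre r n then d (prng n.1) else 0)).
  rewrite (sum_child_pre S_down) // gram; try exact: vS.
  rewrite Nns (_ : s != n) ?andbT ?subrr //.
  by apply: contraFneq Nns => ->; exact: pre_refl.
rewrite big_seq_cond [RHS]big_seq_cond; apply: eq_bigr => r /andP[rS sr].
rewrite gram; try exact: vS; case: ifP => // Nrn; case: ifP => // nr.
case: (pre_child sr nr) => [nE|]; last by rewrite Nns.
by rewrite nE pre_refl in Nrn.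
Qed.

(** Expanding the second atom leaves [mass s] for [n] preceding [s], minus [mass s] for the child of
    [n] preceding [s], if any; the two cancel unless [s = n]. *)
Lemma atom_atom s n : s \in S -> n \in S ->
  t (atom s ** ia_star (atom n)) = if s == n then mass s else 0.
Proof.
move=> sS nS; rewrite {2}/atom (additiveB (@ia_starD _ _ L)) (additive_sum (@ia_starD _ _ L)).
rewrite ka_mulBr ka_mul_sumr (additiveB tD) (additive_sum tD) atom_ev //.
rewrite (_ : \sum_(r <- S | child n r) _ =
    \sum_(r <- S | child n r) (if pre r s then mass s else 0)).
  rewrite (sum_child_pre S_down) //; have [->|ns] := eqVneq s n.
    by rewrite andbF pre_refl subr0.
  by rewrite andbT subrr.
by rewrite big_seq_cond [RHS]big_seq_cond; apply: eq_bigr => r /andP[rS _]; rewrite atom_ev.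
Qed.

Lemma trace_atoms (c : path E * path E -> K) x : x = \sum_(s <- S) c s *: atom s ->
  t (x ** ia_star x) = \sum_(s <- S) (c s * sig (c s)) *: mass s.
Proof.
move=> ->; have [uS _ _] := S_down.
rewrite ka_mul_suml (additive_sum tD) big_seq [RHS]big_seq; apply: eq_bigr => s sS.
rewrite (additive_sum (@ia_starD _ _ L)) ka_mul_sumr (additive_sum tD).
rewrite (bigD1_seq s) //= big_seq_cond big1 ?addr0 => [|n /andP[nS ns]];
  by rewrite ia_starZ ka_mulZl ka_mulZr scalerA tZ atom_atom // ?eqxx // eq_sym (negbTE ns) scaler0.
Qed.

Lemma mass_edges s : valid s -> exists l,
  [/\ uniq l, forall e, e \in l -> src e = prng s.1,
      mass s = d (prng s.1) - \sum_(e <- l) d (rng e) &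
      atom s = ev L s - \sum_(e <- l) ev L (shift s [:: e])].
Proof.
move=> vs; have [uS vS _] := S_down; have [l [ul lE lF]] := children_edges s uS.
exists l; split=> //; first by move=> e; rewrite lE => /vS/valid_shift1[].
  by rewrite /mass lF; congr (_ - _); apply: eq_bigr => e _; rewrite prng_cat.
by rewrite /atom lF.
Qed.

Lemma mass_nonneg s : pos_graph_trace d -> valid s -> nonneg (mass s).
Proof.
move=> [_ dpos] vs; have [l [ul lE -> _]] := mass_edges vs.
by apply: dpos => [|e /In_mem/lE//]; apply/NoDup_uniq.
Qed.

(** Insert the common range between p and q^* and expand it by (CK2). *)
Lemma ev_CK2 s l : valid s -> enum_src (prng s.1) l -> l <> [::] ->
  ev L s = \sum_(e <- l) ev L (shift s [:: e]).
Proof.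
case: s => [[a b] [v m]] [/= vb [vm bm]] sl l0.
transitivity (pval L (a, b) ** lv L (prng (a, b)) ** ia_star (pval L (v, m))).
  by rewrite pval_lv // eqxx.
rewrite (lpa_CK2 L sl l0) ka_mul_sumr ka_mul_suml; apply: eq_bigr => e _.
by rewrite /ev /shift /= !cats1 star_pval_rcons pval_rcons !ka_mulA.
Qed.

(* Zero mass leaves no room for a further edge, so (CK2) kills the atom. *)
Lemma mass_eq0 s : posdef R -> faithful_graph_trace d -> valid s ->
  mass s = 0 -> atom s = 0.
Proof.
move=> Rpd [[_ dpos] dv] vs; have [l [ul lE -> ->]] := mass_edges vs => m0.
apply/eqP; rewrite subr_eq0; apply/eqP; apply: ev_CK2 => //; last first.
  (* With no edge listed, the mass would be the nonzero value of [d] at a vertex. *)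
  by move=> l0; move: m0; rewrite l0 big_nil subr0; case: (dv (prng s.1)).
apply/enum_srcP; split=> // e; apply/idP/eqP => [/lE//|se].
apply: contrapT => /negP el.
(* With a missing edge [e] added, positivity says that [- d (rng e)] is nonnegative. So is
   [d (rng e)], hence it is 0, against faithfulness. *)
have : nonneg (d (prng s.1) - \sum_(f <- e :: l) d (rng f)).
  apply: dpos => [|f /In_mem]; first by apply/NoDup_uniq; rewrite /= el.
  by rewrite in_cons => /orP[/eqP->|/lE].
rewrite big_cons opprD addrCA m0 addr0 => de.
have [dre dre0] := dv (rng e).
by apply: dre0; apply: posdef_nonnegD Rpd dre de _; rewrite subrr.
Qed.
End DownClosed.

Lemma atoms_span x : exists S c, down_closed S /\ x = \sum_(s <- S) c s *: atom S s.
Proof.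
(* Atoms depend on [S], so the induction treats all sufficiently large down-closed sets at once. *)
suff [S0 vS0 H] : exists2 S0 : seq (path E * path E), forall s, s \in S0 -> valid s &
    forall S, down_closed S -> {subset S0 <= S} ->
      exists c, x = \sum_(s <- S) c s *: atom S s.
  have [S dS S0S] := down_closure vS0; have [c xE] := H S dS S0S.
  by exists S, c.
elim: (lpa_span x) => [|a s y vs _ [S0 vS0 H]].
  by exists [::] => // S _ _; exists (fun=> 0); rewrite big1 // => s _; rewrite scale0r.
exists (s :: S0) => [n|S dS S0S]; first by rewrite in_cons => /orP[/eqP->|/vS0].
have [|c ->] := H S dS; first by move=> n nS; apply: S0S; rewrite in_cons nS orbT.
(* By [ev_atoms], the new term adds [a] to the coefficient of each atom at or beyond [s]. *)
exists (fun n => (if pre s n then a else 0) + c n).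
rewrite (ev_atoms dS (S0S s (mem_head _ _))) scaler_sumr -big_split /=.
apply: eq_bigr => n _; rewrite scalerDl; congr (_ + _).
by case: ifP => _; rewrite ?scaler0 ?scale0r.
Qed.

Lemma t_sqr_nonneg x : pos_graph_trace d -> nonneg (t (x ** ia_star x)).
Proof.
move=> dpos; have [S [c [dS xE]]] := atoms_span x; rewrite (trace_atoms dS xE).
have [_ vS _] := dS; rewrite big_seq; apply: (big_ind (@nonneg K sig R)); first exact: nonneg0.
  by move=> ? ?; apply: nonnegD.
by move=> s /vS vs; apply/nonneg_scale/(mass_nonneg dS).
Qed.

(** A vanishing sum of nonnegative terms vanishes termwise, so each atom has coefficient 0 or mass
    0, and in the latter case is itself 0. *)
Lemma t_sqr_eq0 x : posdef R -> faithful_graph_trace d ->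
  t (x ** ia_star x) = 0 -> x = 0.
Proof.
move=> Rpd df; have [S [c [dS xE]]] := atoms_span x; rewrite (trace_atoms dS xE) => t0.
have [_ vS _] := dS; rewrite xE big_seq big1 // => s sS.
have cm0 : (c s * sig (c s)) *: mass S s = 0.
  apply: (posdef_nonneg_sum Rpd _ t0) => // n /vS vn.
  by apply/nonneg_scale/(mass_nonneg dS) => //; case: df.
have [->|c0] := eqVneq (c s) 0; first by rewrite scale0r.
rewrite (mass_eq0 dS) ?scaler0 //; first exact: vS.
move/eqP: cm0; rewrite scaler_eq0 mulf_eq0 fmorph_eq0 orbb (negbTE c0).
by move/eqP.
Qed.

Lemma t_positive : pos_graph_trace d -> positive_map t.
Proof.
move=> dpos x [l ->]; rewrite (additive_sum tD).
by apply: nonneg_sum => z; apply: t_sqr_nonneg.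
Qed.

Lemma t_faithful : posdef R -> faithful_graph_trace d -> faithful_map t.
Proof.
move=> Rpd df x [xpos x0]; have dpos := proj1 df.
split; first exact: t_positive.
move=> tx0; apply: x0; case: xpos tx0 => l ->; rewrite (additive_sum tD) => t0.
rewrite big_seq big1 // => z zl; rewrite (@t_sqr_eq0 z Rpd df) ?ka_mul0l //.
by apply: (posdef_nonneg_sum Rpd _ t0) => // y _; apply: t_sqr_nonneg.
Qed.
End Gram.

(** * Vertices are nonzero *)

Section Vertices.
Variables (K : fieldType) (sig : {rmorphism K -> K}) (E : graph) (L : LPA sig E).

Definition pick_edge (v : vert E) : option (edge E) :=
  if pselect (exists e, src e = v) is left ex then Some (projT1 (cid ex)) else None.

Definition chosen (e : edge E) : bool := pick_edge (src e) == Some e.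

Lemma chosen_unique v l : enum_src v l -> l <> [::] ->
  exists2 e, e \in l & forall f, f \in l -> chosen f = (f == e).
Proof.
move=> /enum_srcP[_ lE] l0; rewrite /chosen /pick_edge.
have ex : exists e, src e = v.
  case: l l0 lE => // e l _ /(_ e); rewrite mem_head => /esym/eqP ev.
  by exists e.
exists (projT1 (cid ex)); first by rewrite lE; case: cid => e /= ->.
move=> f; rewrite lE => /eqP->; case: pselect => [ex'|//].
by rewrite (Prop_irrelevance ex' ex) eq_sym.
Qed.

(* Choosing one edge at every non-sink gives a path from [v] whose vector state
   does not vanish on [v]. *)
Lemma lv_neq0 v : lv L v <> 0.
Proof.
pose phi (s : path E * path E) : K^o :=
  if all chosen s.1.2 && all chosen s.2.2 then 1 else 0.
have [|t [tD _ tE]] := @lpa_functional K sig E L K^o phi.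
  (* Exactly one edge in [l] is chosen; its term reproduces the value at [s] and all others are
     0. *)
  move=> s l vs sl l0; have [e el eE] := chosen_unique sl l0.
  have [ul _] := proj1 (enum_srcP _ _) sl.
  rewrite (bigD1_seq e) //= big_seq_cond big1 ?addr0 => [|f /andP[fl fe]].
    by rewrite /phi /= !all_cat /= eE // eqxx !andbT.
  by rewrite /phi /= !all_cat /= eE // (negbTE fe) !andbF.
move=> v0; have := tE ((v, [::]), (v, [::])) _.
rewrite -/(ev L ((v, [::]), (v, [::]))) ev_vertex v0 (additive0 tD) /phi /=.
by move=> /(_ _)/eqP; rewrite eq_sym oner_eq0 => H; apply: notF; apply: H.
Qed.
End Vertices.

(** * Restricting traces and extending graph traces *)

Section Restriction.
Variables (K : fieldType) (sig : {rmorphism K -> K}) (E : graph) (L : LPA sig E).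
Variable R : invAlg sig.

(** The trace property gives t(r(e)) = t(e e^* ). The difference of v and a finite sum of e e^* is a
    self-adjoint idempotent z, so z = z z^* is nonnegative. *)
Lemma trace_pos_graph_trace (t : L -> R) :
  is_trace t -> positive_map t -> pos_graph_trace (fun v => t (lv L v)).
Proof.
move=> [tD tC] tpos.
have tr e : t (lv L (rng e)) = t (le L e ** ls L e) by rewrite tC ls_le eqxx.
split=> [v l vl l0|v l /NoDup_uniq ul lv_l].
  by rewrite (lpa_CK2 L vl l0) (additive_sum tD); apply: eq_bigr => e _; rewrite tr.
have -> : t (lv L v) - \sum_(e <- l) t (lv L (rng e)) =
    t (lv L v - \sum_(e <- l) le L e ** ls L e).
  by rewrite (additiveB tD) (additive_sum tD); congr (_ - _); apply: eq_bigr.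
set z := _ - _; apply: tpos; exists [:: z]; rewrite big_seq1.
have zs : ia_star z = z.
  rewrite /z (additiveB (@ia_starD _ _ L)) (additive_sum (@ia_starD _ _ L)) lpa_star_v.
  by congr (_ - _); apply: eq_bigr => e _; rewrite ia_starM lpa_star_s lpa_star_e.
rewrite zs /z; set P := \sum_(e <- l) _.
have l_src e : e \in l -> src e = v by move/In_mem/lv_l.
have vP : lv L v ** P = P.
  rewrite /P ka_mul_sumr big_seq [RHS]big_seq; apply: eq_bigr => e /l_src <-.
  by rewrite ka_mulA lv_le.
have Pv : P ** lv L v = P.
  rewrite /P ka_mul_suml big_seq [RHS]big_seq; apply: eq_bigr => e /l_src <-.
  by rewrite -ka_mulA ls_lv.
have PP : P ** P = P.
  rewrite {1}/P ka_mul_suml [RHS]big_seq big_seq; apply: eq_bigr => e el.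
  rewrite -ka_mulA; congr (_ ** _); rewrite /P ka_mul_sumr (bigD1_seq e) //=.
  rewrite big1 ?addr0 => [|f fe]; rewrite ka_mulA ls_le.
    by rewrite eqxx; have [_ [_ [_ [_ [H _]]]]] := lpa_family L; exact: H.
  by rewrite eq_sym (negbTE fe) ka_mul0l.
by rewrite ka_mulBr !ka_mulBl vP Pv PP lv_mul eqxx subrr subr0.
Qed.

(** Faithfulness concerns nonzero elements; with t(0) = 0 it yields positivity. Each vertex is
    nonzero and equals v v^*, hence is positive. *)
Lemma trace_faithful_graph_trace (t : L -> R) :
  is_trace t -> faithful_map t -> faithful_graph_trace (fun v => t (lv L v)).
Proof.
move=> ttr tf; have tpos : positive_map t.
  move=> x xpos; have [->|x0] := pselect (x = 0); last by case: (tf x).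
  by rewrite (additive0 (proj1 ttr)); exact: nonneg0.
split; first exact: trace_pos_graph_trace.
move=> v; apply: tf; split; last exact: lv_neq0.
by exists [:: lv L v]; rewrite big_seq1 lpa_star_v lv_mul eqxx.
Qed.

(** Compatibility with (CK2) is the graph trace identity when p = q. Otherwise both sides are 0, as
    pe = qe forces p = q. *)
Lemma graph_trace_extension (d : vert E -> R) : graph_trace d ->
  exists t : L -> R, [/\ is_trace t, klinear t &
    forall s, valid s -> t (ev L s) = if s.1 == s.2 then d (prng s.1) else 0].
Proof.
move=> dtr.
have [|t [tD tZ tE]] := @lpa_functional K sig E L R
  (fun s => if s.1 == s.2 then d (prng s.1) else 0).
  move=> s l vs sl l0; have [ss|ss] := eqVneq s.1 s.2.
    rewrite (dtr _ _ sl l0); apply: eq_bigr => e _.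
    by rewrite /= ss eqxx prng_cat.
  rewrite big1 // => e _; case: eqP => // -[ss1].
  rewrite !cats1 => /rcons_inj[ss2]; case/eqP: ss.
  by rewrite (surjective_pairing s.1) ss1 ss2 -surjective_pairing.
by exists t; split=> //; apply: (t_trace (d := d)).
Qed.

Lemma canonical_of_ev (d : vert E -> R) (t : L -> R) :
    (forall s, valid s -> t (ev L s) = if s.1 == s.2 then d (prng s.1) else 0) ->
  canonical_trace t /\ forall v, t (lv L v) = d v.
Proof.
move=> tE; have tv v : t (lv L v) = d v by rewrite -ev_vertex tE //= eqxx.
split=> // p q pP qP pq; rewrite -[_ ** _]/(ev L (p, q)) tE //= tv.
by split=> [->|/eqP/negbTE->//]; rewrite eqxx.
Qed.

Lemma canonical_trace_unique (t1 t2 : L -> R) :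
    is_trace t1 -> klinear t1 -> canonical_trace t1 ->
    is_trace t2 -> klinear t2 -> canonical_trace t2 ->
  (forall v, t1 (lv L v) = t2 (lv L v)) -> forall x, t1 x = t2 x.
Proof.
move=> [t1D _] t1Z t1c [t2D _] t2Z t2c tv x.
elim: (lpa_span x) => [|a [p q] y [pP [qP pq]] _ IH].
  by rewrite (additive0 t1D) (additive0 t2D).
rewrite t1D t2D t1Z t2Z IH; congr (_ *: _ + _).
have [e1 n1] := t1c p q pP qP pq; have [e2 n2] := t2c p q pP qP pq.
by have [e|n] := pselect (p = q); [rewrite /ev /= e1 // e2 // tv|rewrite /ev /= n1 // n2].
Qed.
End Restriction.

(** Each bijection is expressed by two clauses, restriction being well defined and surjective;
    injectivity in both cases is the uniqueness clause. *)
Theorem theorem3p6 (K : fieldType) (sig : {rmorphism K -> K})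
    (sigK : involutive sig) (E : graph) (L : LPA sig E) (R : invAlg sig) :
  (* uniqueness: a canonical K-linear trace is determined by its values on E^0 *)
  (forall t1 t2 : L -> R,
     is_trace t1 -> klinear t1 -> canonical_trace t1 ->
     is_trace t2 -> klinear t2 -> canonical_trace t2 ->
     (forall v, t1 (lv L v) = t2 (lv L v)) -> forall x, t1 x = t2 x) /\
  (* positive case *)
  (forall t : L -> R, is_trace t -> klinear t -> canonical_trace t ->
     positive_map t -> pos_graph_trace (fun v => t (lv L v))) /\
  (forall d : vert E -> R, pos_graph_trace d ->
     exists t : L -> R, [/\ is_trace t, klinear t, canonical_trace t,
       positive_map t & forall v, t (lv L v) = d v]) /\
  (* faithful case, when the involution of R is positive definite *)
  (posdef R ->
    (forall t : L -> R, is_trace t -> klinear t -> canonical_trace t ->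
       faithful_map t -> faithful_graph_trace (fun v => t (lv L v))) /\
    (forall d : vert E -> R, faithful_graph_trace d ->
       exists t : L -> R, [/\ is_trace t, klinear t, canonical_trace t,
         faithful_map t & forall v, t (lv L v) = d v])).
Proof.
split; first exact: canonical_trace_unique.
split; first by move=> t ttr _ _; exact: trace_pos_graph_trace.
split.
  move=> d dpos; have [t [ttr tZ tE]] := graph_trace_extension L (proj1 dpos).
  have [tc tv] := canonical_of_ev tE; exists t; split=> //.
  exact: (t_positive (proj1 ttr) tZ tE).
move=> Rpd; split; first by move=> t ttr _ _; exact: trace_faithful_graph_trace.
move=> d df; have [t [ttr tZ tE]] := graph_trace_extension L (proj1 (proj1 df)).
have [tc tv] := canonical_of_ev tE; exists t; split=> //.
exact: (t_faithful (proj1 ttr) tZ tE).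
Qed.
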